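(* Let $G=(V,E)$ be a finite simple graph with maximum vertex degree $\Delta$, let $w\in(0,1)$ and let $M\subseteq E$. Suppose the even subgraph model on $G$ with measure $\lambda(A)=w^{|A\oplus M|}$ has $(\chi_2,\chi_4)$-bounded defect susceptibility, i.e. \[ \frac{\lambda(\mathcal C_2)}{\lambda(\mathcal C_0)}\le \chi_2,\qquad \frac{\lambda(\mathcal C_4)}{\lambda(\mathcal C_0)}\le \chi_4 . \] Then the relaxation time of the lazy worm process on $\mathcal W=\mathcal C_0\cup\mathcal C_2$ satisfies \[ t_{\rm rel}\le 8\,\Delta\, w^{-1}\,|E|\,\bigl[(1+\chi_2)(2+|V|)+2\chi_4\bigr]. \]
   Context: Subgraphs of $G$ are identified with edge subsets $A\subseteq E$; $\oplus$ denotes symmetric difference, $d(u)$ the degree of vertex $u$ in $G$, and $\partial A$ the set of vertices having odd degree in $(V,A)$. $\mathcal C_k=\{A\subseteq E: |\partial A|=k\}$, and for a set $\mathcal S$ of subgraphs $\lambda(\mathcal S)=\sum_{A\in\mathcal S}\lambda(A)$, where $\lambda(A)=w^{|A\oplus M|}$. The state space is $\mathcal W=\mathcal C_0\cup\mathcal C_2$, equipped with the Prokof'ev–Svistunov measure $\pi(A)=\Psi(A)\lambda(A)/(|V|\lambda(\mathcal C_0)+2\lambda(\mathcal C_2))$, where $\Psi(A)=|V|$ if $A\in\mathcal C_0$ and $\Psi(A)=2$ if $A\in\mathcal C_2$. The lazy worm process is the Markov chain on $\mathcal W$ whose transition matrix $P$ is as follows: for $A\in\mathcal W$ and an edge $e=uv\in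 E$ with $A\oplus e\in\mathcal W$, (i) if $A\in\mathcal C_0$: $P(A,A\oplus e)=w^{\mathbf 1[e\notin A\oplus M]}\frac{1}{2|V|}\bigl(\frac1{d(u)}+\frac1{d(v)}\bigr)$; (ii) if $A\in\mathcal C_2$ and $A\oplus e\in\mathcal C_0$: $P(A,A\oplus e)=w^{\mathbf 1[e\notin A\oplus M]}\frac14\bigl(\frac1{d(u)}+\frac1{d(v)}\bigr)$; (iii) if $A\in\mathcal C_2$, $A\oplus e\in\mathcal C_2$ and $u\in\partial A$: $P(A,A\oplus e)=\min\!\bigl(\frac{d(u)}{d(v)}w^{\mathbf 1[e\notin A\oplus M]-\mathbf 1[e\in A\oplus M]},1\bigr)\frac{1}{4d(u)}$; all other off-diagonal entries are $0$ and $P(A,A)=1-\sum_{B\neq A}P(A,B)$. The relaxation time is $t_{\rm rel}=1/\gamma_\ast$, where $\gamma_\ast=1-\max\{|\mu|:\mu\ne 1 \text{ an eigenvalue of } P\}$ is the absolute spectral gap of $P$. *)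

(* Defs.v *)
From HB Require Import structures.
From mathcomp Require Import all_boot all_order all_algebra.
From mathcomp Require Import reals.
From mathcomp Require Import complex.

Set Implicit Arguments.
Unset Strict Implicit.
Unset Printing Implicit Defensive.

Import Order.TTheory GRing.Theory Num.Theory.
Local Open Scope ring_scope.

Section Worm.
(* Finite simple graph G = (V, E): vertex type T, adjacency relation adj,
   assumed symmetric and irreflexive in the theorem. *)
Variables (T : finType) (adj : rel T).

Definition edges : {set {set T}} :=
  [set e : {set T} | [exists u, exists v, adj u v && (e == [set u; v])]].

Definition deg (u : T) : nat := #|[set v | adj u v]|.

Definition maxdeg : nat := \max_(u : T) deg u.

Definition symdiff (A B : {set {set T}}) : {set {set T}} :=
  (A :\: B) :|: (B :\: A).

Definition oddv (A : {set {set T}}) : {set T} :=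
  [set u | odd #|[set e in A | u \in e]|].

Definition Ck (k : nat) : {set {set {set T}}} :=
  [set A : {set {set T}} | (A \subset edges) && (#|oddv A| == k)].

Variables (R : realType) (w : R) (M : {set {set T}}).

Definition lam (A : {set {set T}}) : R := w ^+ #|symdiff A M|.

Definition lamS (S : {set {set {set T}}}) : R := \sum_(A in S) lam A.

Definition Wset : {set {set {set T}}} := Ck 0 :|: Ck 2.
Definition Wty : finType := {A : {set {set T}} | A \in Wset}.

(* the rate of flipping edge e = uv in state A, as given by (i)-(iii);
   for (iii) the formula is taken with the endpoint lying in \partial A
   (the expression is symmetric in u, v whenever the move is valid). *)
Definition rate (A : {set {set T}}) (u v : T) : R :=
  let e := [set u; v] in
  let B := symdiff A [set e] in
  let inAM := e \in symdiff A M in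
  let s : R := if inAM then 1 else w in
  let t : R := if inAM then w^-1 else w in
  let du : R := (deg u)%:R in
  let dv : R := (deg v)%:R in
  if #|oddv A| == 0%N then
    s * ((2 * (#|T|)%:R)^-1 * (du^-1 + dv^-1))
  else if #|oddv B| == 0%N then
    s * (4^-1 * (du^-1 + dv^-1))
  else if u \in oddv A then
    Num.min (du / dv * t) 1 * (4 * du)^-1
  else
    Num.min (dv / du * t) 1 * (4 * dv)^-1.

(* off-diagonal entry P(A,B), A != B: sum over the (unique, if any) edge e
   with B = A (+) e; each edge {u,v} is visited twice as (u,v) and (v,u),
   hence the factor 1/2 *)
Definition Poff (A B : {set {set T}}) : R :=
  2^-1 * \sum_(u : T) \sum_(v : T | adj u v && (B == symdiff A [set [set u; v]]))
           rate A u v.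

Definition Pw (A B : Wty) : R :=
  if A == B then 1 - \sum_(C : Wty | C != A) Poff (val A) (val C)
  else Poff (val A) (val B).

Definition Pmx : 'M[R]_#|Wty| :=
  \matrix_(i, j) Pw (enum_val i) (enum_val j).

(* t_rel <= B, where t_rel = 1/gamma_*, gamma_* = 1 - max{|mu| : mu != 1
   eigenvalue of P} (complex eigenvalues): every nontrivial eigenvalue mu
   satisfies |mu| < 1 and 1/(1 - |mu|) <= B. *)
Definition trel_le (Bd : R) : Prop :=
  forall mu : R[i],
    eigenvalue (map_mx (fun x : R => x%:C%C) Pmx) mu -> mu != 1 ->
    `|mu| < 1 /\ (1 - `|mu|)^-1 <= Bd%:C%C.

End Worm.

(* Main.v *)
Require Import Defs.
From mathcomp Require Import all_boot all_order all_algebra.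
From mathcomp Require Import boolp reals.
From mathcomp Require Import complex.
From mathcomp Require Import ring lra zify.

Set Implicit Arguments.
Unset Strict Implicit.
Unset Printing Implicit Defensive.

Import Order.TTheory GRing.Theory Num.Theory.
Local Open Scope ring_scope.

(** The chain is reversible for [ps_weight A = #|heads A| * lam A] and stays put
    with probability at least 1/2, so its eigenvalues lie in [[0, 1]] and it
    suffices to prove a Poincaré inequality. The variance is at most the mean of
    [(g A - g B) ^+ 2] with [A] drawn from [ps_weight] and [B] from [lam]
    restricted to the even subgraphs; the difference is telescoped along a path
    from [A] to [B] that flips each edge of [D = symdiff A B] once, in an order
    that depends on [D] only. If [X] is a state on the path, the encoding
    [symdiff X D] agrees edge by edge with whichever of [A] and [B] the state [X]
    does not, so [lam A * lam B = lam X * lam (symdiff X D)], and it has at most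
    four odd vertices. For a fixed transition [D] is recovered from the encoding, so the
    congestion is at most the total weight of the possible encodings. *)

Section SquareSums.
Variable I : finType.

Lemma sum_sqr_dist (R : comPzRingType) (P Q : pred I) (r m g : I -> R) :
  \sum_(x | P x) \sum_(y | Q y) r x * m y * (g x - g y) ^+ 2 =
  (\sum_(x | P x) r x * g x ^+ 2) * (\sum_(y | Q y) m y)
  - 2 * ((\sum_(x | P x) r x * g x) * (\sum_(y | Q y) m y * g y))
  + (\sum_(x | P x) r x) * (\sum_(y | Q y) m y * g y ^+ 2).
Proof.
rewrite !mulr_suml mulr_sumr -sumrB -big_split; apply: eq_bigr => x _.
rewrite !mulr_sumr -sumrB -big_split; apply: eq_bigr => y _ /=; ring.
Qed.

Lemma second_moment_le (R : realDomainType) (P Q : pred I) (r m g : I -> R) :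
  (forall x, 0 <= r x) -> (forall y, 0 <= m y) -> \sum_(x | P x) r x * g x = 0 ->
  (\sum_(y | Q y) m y) * (\sum_(x | P x) r x * g x ^+ 2) <=
  \sum_(x | P x) \sum_(y | Q y) r x * m y * (g x - g y) ^+ 2.
Proof.
move=> r_ge0 m_ge0 mean0; rewrite sum_sqr_dist mean0 mul0r mulr0 subr0.
by rewrite mulrC lerDl mulr_ge0 ?sumr_ge0 // => y _; rewrite mulr_ge0 ?sqr_ge0.
Qed.

Lemma sqr_sum_le (R : realDomainType) (D : {set I}) (a : I -> R) :
  (\sum_(i in D) a i) ^+ 2 <= #|D|%:R * \sum_(i in D) a i ^+ 2.
Proof.
have : 0 <= \sum_(i in D) \sum_(j in D) 1 * 1 * (a i - a j) ^+ 2.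
  by apply: sumr_ge0 => i _; apply: sumr_ge0 => j _; rewrite !mul1r sqr_ge0.
have mul1 (b : I -> R) : \sum_(i in D) 1 * b i = \sum_(i in D) b i.
  by apply: eq_bigr => i _; rewrite mul1r.
by rewrite sum_sqr_dist !mul1 sumr_const; lra.
Qed.

End SquareSums.

(** * Spectral gap of reversible kernels *)

Section Eigenfunctions.
Variable I : finType.

Definition kernel_mx (F : Type) (p : I -> I -> F) : 'M[F]_#|I| :=
  \matrix_(i, j) p (enum_val i) (enum_val j).

Definition eigenfunction (F : nzRingType) (p : I -> I -> F) (mu : F) (h : I -> F) :
  Prop := (exists x, h x != 0) /\ forall x, \sum_y p x y * h y = mu * h x.

Lemma map_kernel_mx (F K : Type) (f : F -> K) (p : I -> I -> F) :
  map_mx f (kernel_mx p) = kernel_mx (fun x y => f (p x y)).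
Proof. by apply/matrixP => i j; rewrite !mxE. Qed.

Lemma eigenvalue_trmx (F : fieldType) n (A : 'M[F]_n) mu :
  eigenvalue A^T mu = eigenvalue A mu.
Proof.
rewrite /eigenvalue /eigenspace !kermx_eq0 /row_free.
by rewrite -{1}tr_scalar_mx -linearB mxrank_tr.
Qed.

Lemma eigenvalue_kernel_mx (F : fieldType) (p : I -> I -> F) mu :
  eigenvalue (kernel_mx p) mu -> exists h, eigenfunction p mu h.
Proof.
rewrite -eigenvalue_trmx => /eigenvalueP [v vP v_neq0].
exists (fun x => v 0 (enum_rank x)); split=> [|x].
  have [i vi] := rV0Pn _ v_neq0; by exists (enum_val i); rewrite enum_valK.
have := congr1 (fun u : 'rV_ _ => u 0 (enum_rank x)) vP; rewrite !mxE => <-.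
rewrite (reindex (@enum_rank I)) /=; last by apply: onW_bij; exact: enum_rank_bij.
by apply: eq_bigr => y _; rewrite !mxE !enum_rankK mulrC.
Qed.

Lemma eigenvalue_subsingleton (R : nzRingType) (F : fieldType) (f : {rmorphism R -> F})
    (p : I -> I -> R) mu :
  (forall x y : I, x = y) -> (forall x, \sum_y p x y = 1) ->
  eigenvalue (map_mx f (kernel_mx p)) mu -> mu = 1.
Proof.
move=> single p_sum1; rewrite map_kernel_mx => /eigenvalue_kernel_mx [h [[x hx] Ph]].
apply: (mulIf hx); rewrite -Ph -(rmorph1 f) -(p_sum1 x) rmorph_sum mulr_suml.
by apply: eq_bigr => y _; rewrite (single y x).
Qed.

Definition stochastic (R : numDomainType) (p : I -> I -> R) : Prop :=
  (forall x y, 0 <= p x y) /\ (forall x, \sum_y p x y = 1).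

Definition lazy (R : numFieldType) (p : I -> I -> R) : Prop :=
  forall x, 2^-1 <= p x x.

(* Gershgorin's circle around [p x x] at a point [x] where [`|h|] is maximal. *)
Lemma eigenvalue_stochastic_lazy (R : realFieldType) (p : I -> I -> R) mu (h : I -> R) :
  stochastic p -> lazy p -> eigenfunction p mu h -> 0 <= mu <= 1.
Proof.
move=> [p_ge0 p_sum1] p_lazy [[x0 hx0] Ph].
have [x _ h_le] := @arg_maxP _ _ I x0 xpredT (fun x => `|h x|) isT.
have hx : 0 < `|h x| by rewrite (lt_le_trans _ (h_le x0 isT)) ?normr_gt0.
have off1 : \sum_(y | y != x) p x y = 1 - p x x.
  by rewrite -(p_sum1 x) [in RHS](bigD1 x) //= addrAC subrr add0r.
have : `|mu - p x x| <= 1 - p x x.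
  rewrite -(ler_pM2r hx) -normrM mulrBl -Ph (bigD1 x) //= addrAC subrr add0r.
  rewrite -off1 mulr_suml.
  apply: le_trans (ler_norm_sum _ _ _) _; apply: ler_sum => y _.
  by rewrite normrM ger0_norm //; apply: ler_wpM2l => //; exact: h_le.
by rewrite ler_norml => /andP[]; move: (p_lazy x) => *; apply/andP; split; lra.
Qed.

End Eigenfunctions.

Section ReversibleKernels.
Variable I : finType.

Definition reversible (F : pzSemiRingType) (r : I -> F) (p : I -> I -> F) : Prop :=
  forall x y, r x * p x y = r y * p y x.

Lemma reversible_selfadjoint (F : comPzRingType) (r : I -> F) (p : I -> I -> F) f g :
  reversible r p ->
  \sum_x r x * f x * (\sum_y p x y * g y) = \sum_x r x * g x * (\sum_y p x y * f y).
Proof.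
move=> p_rev; under eq_bigr do rewrite mulr_sumr; rewrite exchange_big /=.
apply: eq_bigr => y _; rewrite mulr_sumr; apply: eq_bigr => x _.
by rewrite mulrACA p_rev; ring.
Qed.

Lemma weighted_sqr_norm_gt0 (F : numDomainType) (r h : I -> F) :
  (forall x, 0 < r x) -> (exists x, h x != 0) -> 0 < \sum_x r x * `|h x| ^+ 2.
Proof.
move=> r_gt0 [x hx]; rewrite (bigD1 x) //= ltr_pwDl ?mulr_gt0 ?exprn_gt0 ?normr_gt0 //.
by apply: sumr_ge0 => y _; rewrite mulr_ge0 ?exprn_ge0 // ltW.
Qed.

Lemma reversible_eigenvalue_real (F : numClosedFieldType)
    (r : I -> F) (p : I -> I -> F) mu h :
  (forall x, 0 < r x) -> (forall x y, p x y \is Num.real) -> reversible r p ->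
  eigenfunction p mu h -> mu \is Num.real.
Proof.
move=> r_gt0 p_real p_rev [/(weighted_sqr_norm_gt0 r_gt0) N_gt0 Ph]; apply/CrealP.
have Pconj x : \sum_y p x y * (h y)^* = (mu * h x)^*.
  rewrite -Ph rmorph_sum; apply: eq_bigr => y _.
  by rewrite rmorphM /= (CrealP (p_real x y)).
apply: (mulIf (lt0r_neq0 N_gt0)); rewrite !mulr_sumr.
transitivity (\sum_x r x * h x * \sum_y p x y * (h y)^*).
  by apply: eq_bigr => x _; rewrite Pconj rmorphM normCK; ring.
rewrite reversible_selfadjoint //; apply: eq_bigr => x _.
by rewrite Ph normCK; ring.
Qed.

Variables (R : rcfType) (r : I -> R) (p : I -> I -> R).
Hypotheses (r_gt0 : forall x, 0 < r x) (p_rev : reversible r p).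

Definition dirichlet (g : I -> R) : R :=
  2^-1 * \sum_x \sum_y r x * p x y * (g x - g y) ^+ 2.

Definition poincare_inequality (C : R) : Prop :=
  forall g : I -> R, \sum_x r x * g x = 0 ->
    \sum_x r x * g x ^+ 2 <= C * dirichlet g.

Lemma dirichletE g : (forall x, \sum_y p x y = 1) ->
  dirichlet g = \sum_x r x * g x ^+ 2 - \sum_x r x * g x * (\sum_y p x y * g y).
Proof.
move=> p_sum1.
have sqr_fst : \sum_x \sum_y r x * p x y * g x ^+ 2 = \sum_x r x * g x ^+ 2.
  by apply: eq_bigr => x _; rewrite -mulr_suml -mulr_sumr p_sum1 mulr1.
have sqr_snd : \sum_x \sum_y r x * p x y * g y ^+ 2 = \sum_x r x * g x ^+ 2.
  rewrite exchange_big -sqr_fst /=; apply: eq_bigr => x _; apply: eq_bigr => y _.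
  by rewrite p_rev.
apply: (@mulfI R 2); rewrite ?pnatr_eq0 // /dirichlet mulVKf ?pnatr_eq0 //.
rewrite mulrBr mulr2n mulrDl mul1r -{1}sqr_fst -sqr_snd mulr_sumr -big_split -sumrB.
apply: eq_bigr => x _.
rewrite !mulr_sumr -big_split -sumrB; apply: eq_bigr => y _ /=; ring.
Qed.

Lemma eigenfunction_mean0 mu h :
  stochastic p -> eigenfunction p mu h -> mu != 1 -> \sum_x r x * h x = 0.
Proof.
move=> [_ p_sum1] [_ Ph] mu_neq1; apply: (mulfI (_ : 1 - mu != 0)).
  by rewrite subr_eq0 eq_sym.
rewrite mulr0 mulrBl mul1r; apply/eqP; rewrite subr_eq0; apply/eqP.
transitivity (\sum_x r x * h x * (\sum_y p x y * 1)).
  by apply: eq_bigr => x _; rewrite -mulr_suml p_sum1 !mulr1.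
rewrite reversible_selfadjoint // mulr_sumr; apply: eq_bigr => x _.
by rewrite Ph; ring.
Qed.

Lemma eigenvalue_poincare (C mu : R) h :
  stochastic p -> lazy p -> poincare_inequality C -> eigenfunction p mu h -> mu != 1 ->
  0 <= mu < 1 /\ (1 - mu)^-1 <= C.
Proof.
move=> p_stoch p_lazy pC h_eigen mu_neq1.
have /andP[mu_ge0 mu_le1] := eigenvalue_stochastic_lazy p_stoch p_lazy h_eigen.
have mu_lt1 : mu < 1 by rewrite lt_neqAle mu_neq1.
split; first by rewrite mu_ge0.
have := pC h (eigenfunction_mean0 p_stoch h_eigen mu_neq1).
case: p_stoch h_eigen => _ p_sum1 [/(weighted_sqr_norm_gt0 r_gt0) + Ph].
rewrite dirichletE //.
under eq_bigr do rewrite real_normK ?num_real //.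
set N := \sum_x r x * h x ^+ 2 => N_gt0.
have -> : \sum_x r x * h x * (\sum_y p x y * h y) = mu * N.
  by rewrite mulr_sumr; apply: eq_bigr => x _; rewrite Ph; ring.
have -> : C * (N - mu * N) = C * (1 - mu) * N by ring.
by rewrite -{1}[N]mul1r ler_pM2r // -ler_pdivrMr ?subr_gt0 // div1r.
Qed.

Lemma eigenfunction_real (m : R) h :
  eigenfunction (fun x y => (p x y)%:C%C) m%:C%C h -> exists f, eigenfunction p m f.
Proof.
move=> [[x0 hx0] Ph].
have part_eigen (part : {additive R[i] -> R}) :
    (forall a z, part (a%:C%C * z) = a * part z) ->
    forall x, \sum_y p x y * part (h y) = m * part (h x).
  move=> partZ x; rewrite -partZ -Ph raddf_sum.
  by apply: eq_bigr => y _; rewrite partZ.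
have ReZ a (z : R[i]) : complex.Re (a%:C%C * z) = a * complex.Re z.
  by case: z => b c /=; rewrite mul0r subr0.
have ImZ a (z : R[i]) : complex.Im (a%:C%C * z) = a * complex.Im z.
  by case: z => b c /=; rewrite mul0r addr0.
move: hx0; rewrite eq_complex negb_and => /orP[] hx0.
  by exists (fun x => complex.Re (h x)); split; [exists x0 | exact: part_eigen ReZ].
by exists (fun x => complex.Im (h x)); split; [exists x0 | exact: part_eigen ImZ].
Qed.

Lemma spectral_gap_poincare (C : R) (mu : R[i]) :
  stochastic p -> lazy p -> poincare_inequality C ->
  eigenvalue (map_mx (real_complex R) (kernel_mx p)) mu -> mu != 1 ->
  `|mu| < 1 /\ (1 - `|mu|)^-1 <= C%:C%C.
Proof.
move=> p_stoch p_lazy pC; rewrite map_kernel_mx => /eigenvalue_kernel_mx [h h_eigen].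
have /complex_realP [m muE] : mu \is Num.real.
  apply: (reversible_eigenvalue_real (r := fun x => (r x)%:C%C) _ _ _ h_eigen)
    => [x|x y|x y].
  - by rewrite ltcR.
  - by apply/complex_realP; exists (p x y).
  - by rewrite -!rmorphM p_rev.
move: h_eigen; rewrite {}muE -(rmorph1 (real_complex R)) (inj_eq (@complexI R)).
move=> /eigenfunction_real [f f_eigen] m_neq1.
have [/andP[m_ge0 m_lt1] mC] := eigenvalue_poincare p_stoch p_lazy pC f_eigen m_neq1.
by rewrite ger0_norm ?ler0c // -rmorphB -fmorphV /= ltcR lecR.
Qed.

End ReversibleKernels.

(** * Parity of degrees *)

Section Parity.
Variable T : finType.
Implicit Types (A B D X : {set {set T}}) (e : {set T}) (s : seq {set T}).

Local Notation "A :+: B" := (symdiff A B) (at level 50, left associativity).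

Lemma in_symdiff A B e : (e \in A :+: B) = (e \in A) (+) (e \in B).
Proof. by rewrite !inE; case: (e \in A); case: (e \in B). Qed.

Lemma symdiffC : commutative (@symdiff T).
Proof. by move=> A B; apply/setP => e; rewrite !in_symdiff addbC. Qed.

Lemma symdiffA : associative (@symdiff T).
Proof. by move=> A B D; apply/setP => e; rewrite !in_symdiff addbA. Qed.

Lemma symdiff0 : right_id set0 (@symdiff T).
Proof. by move=> A; apply/setP => e; rewrite in_symdiff inE addbF. Qed.

Lemma symdiffK A B : A :+: B :+: B = A.
Proof. by apply/setP => e; rewrite !in_symdiff addbK. Qed.

Lemma symKdiff A B : A :+: (A :+: B) = B.
Proof. by rewrite symdiffC (symdiffC A) symdiffK. Qed.

Lemma symdiff_inj B : injective (fun A => A :+: B).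
Proof. by move=> A A' /(congr1 (fun X => X :+: B)); rewrite !symdiffK. Qed.

Lemma symdiff_sub A B X : A \subset X -> B \subset X -> A :+: B \subset X.
Proof. by move=> AX BX; rewrite subUset !(subset_trans (subsetDl _ _)). Qed.

Lemma symdiff_setD A B : B \subset A -> A :+: B = A :\: B.
Proof. by rewrite -setD_eq0 /symdiff => /eqP ->; rewrite setU0. Qed.

Lemma odd_card_big (I : finType) (S : {set I}) :
  odd #|S| = \big[addb/false]_i (i \in S).
Proof.
rewrite -sum1_card (big_morph odd oddD (erefl (odd 0))) big_mkcond.
by apply: eq_bigr => i _; case: (i \in S).
Qed.

Lemma mem_oddv A u : (u \in oddv A) = \big[addb/false]_(e in A) (u \in e).
Proof.
rewrite inE odd_card_big [RHS]big_mkcond.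
by apply: eq_bigr => e _; rewrite inE; case: (e \in A).
Qed.

Lemma mem_oddv_symdiff A B u :
  (u \in oddv (A :+: B)) = (u \in oddv A) (+) (u \in oddv B).
Proof.
rewrite !mem_oddv big_mkcond [X in X (+) _]big_mkcond [X in _ (+) X]big_mkcond.
rewrite -big_split; apply: eq_bigr => e _; rewrite in_symdiff /=.
by case: (e \in A); case: (e \in B); rewrite ?addbb ?addbF.
Qed.

Lemma oddv0 : oddv (set0 : {set {set T}}) = set0.
Proof. by apply/setP => u; rewrite mem_oddv big_set0 inE. Qed.

Lemma oddv1 e : oddv [set e] = e.
Proof. by apply/setP => u; rewrite mem_oddv big_set1. Qed.

Lemma mem_oddv_flip A e u : (u \in oddv (A :+: [set e])) = (u \in oddv A) (+) (u \in e).
Proof. by rewrite mem_oddv_symdiff oddv1. Qed.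

Lemma oddv_symdiff_even A B : oddv A = set0 -> oddv (A :+: B) = oddv B.
Proof. by move=> A0; apply/setP => u; rewrite mem_oddv_symdiff A0 inE. Qed.

Lemma card_oddv_symdiff A B : (#|oddv (A :+: B)| <= #|oddv A| + #|oddv B|)%N.
Proof.
apply: leq_trans (leq_card_setU _ _); apply: subset_leq_card.
by apply/subsetP => u; rewrite in_setU mem_oddv_symdiff; case: (u \in oddv A).
Qed.

Lemma odd_card_oddv A : odd #|oddv A| = \big[addb/false]_(e in A) odd #|e|.
Proof.
rewrite odd_card_big; under eq_bigr do rewrite mem_oddv.
by rewrite exchange_big; apply: eq_bigr => e _; rewrite odd_card_big.
Qed.

Lemma oddv_incident A u : u \in oddv A -> exists2 e, e \in A & u \in e.
Proof. by rewrite inE => /odd_gt0 /card_gt0P [e]; rewrite inE => /andP[]; exists e. Qed.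

(* An edge at an odd vertex, or any edge if there is none. *)
Lemma exists_setD1_oddv_le2 D : {in D, forall e, #|e| = 2%N} -> D != set0 ->
  (#|oddv D| <= 2)%N -> exists2 e, e \in D & (#|oddv (D :\ e)| <= 2)%N.
Proof.
move=> D_card2 D_neq0 D_le2.
have flipE e : e \in D -> D :\ e = D :+: [set e].
  by move=> eD; rewrite symdiff_setD // sub1set.
have [D_even|[x xD]] := set_0Vmem (oddv D).
  have [e eD] := set0Pn _ D_neq0; exists e => //.
  by rewrite flipE // oddv_symdiff_even // oddv1 D_card2.
have [e eD xe] := oddv_incident xD; exists e => //; rewrite flipE //.
have : oddv (D :+: [set e]) \subset (oddv D :\ x) :|: (e :\ x).
  apply/subsetP => u; rewrite mem_oddv_flip !in_setU !in_setD1.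
  by case: eqVneq => [->|] /=; rewrite ?xD ?xe //; case: (u \in oddv D).
move/subset_leq_card/leq_trans; apply; apply: leq_trans (leq_card_setU _ _) _.
have := cardsD1 x (oddv D); have := cardsD1 x e; rewrite xD xe D_card2 //; lia.
Qed.

(* [s] is the order of the flips and [drop n s] what remains of [D] after [n] of them. *)
Definition unwinding D s : Prop :=
  [/\ uniq s, [set:: s] = D & forall n, (#|oddv [set:: drop n s]| <= 2)%N].

(* Greedy removal keeps at most two odd vertices at every stage, so no decomposition
   of [D] into a path and cycles is needed. *)
Lemma exists_unwinding D : {in D, forall e, #|e| = 2%N} -> (#|oddv D| <= 2)%N ->
  exists s, unwinding D s.
Proof.
have [n] := ubnP #|D|; elim: n D => // n IH D D_lt D_card2 D_le2.
have [->|D_neq0] := eqVneq D set0.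
  by exists [::]; split=> [||n']; rewrite ?set_nil ?oddv0 ?cards0.
have [e eD De_le2] := exists_setD1_oddv_le2 D_card2 D_neq0 D_le2.
have [||//|s [s_uniq sE s_le2]] := IH (D :\ e).
- by rewrite (cardsD1 e D) eD in D_lt.
- by move=> f /setD1P[_]; exact: D_card2.
have s'E : [set:: e :: s] = D by rewrite set_cons sE setD1K.
exists (e :: s); split=> // [|[|m]]; rewrite ?drop0 ?s'E //=.
by rewrite s_uniq andbT; apply/negP => es; have := setD11 e D; rewrite -sE inE es.
Qed.

Lemma exists_unwinding_order :
  exists order : {set {set T}} -> seq {set T}, forall D,
    {in D, forall e, #|e| = 2%N} -> (#|oddv D| <= 2)%N -> unwinding D (order D).
Proof.
suff ex_order D : exists s, {in D, forall e, #|e| = 2%N} -> (#|oddv D| <= 2)%N ->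
    unwinding D s by have [order] := choice ex_order; exists order.
have [[D_card2 D_le2]|not_D] :=
    pselect ({in D, forall e, #|e| = 2%N} /\ (#|oddv D| <= 2)%N).
  by have [s] := exists_unwinding D_card2 D_le2; exists s.
by exists [::] => D_card2 D_le2; case: not_D.
Qed.

Definition preceding s e : {set {set T}} := [set:: take (index e s) s].

Lemma preceding_sub s e : preceding s e \subset [set:: s].
Proof. by apply/subsetP => f; rewrite !inE => /mem_take. Qed.

Lemma set_take_drop s n : uniq s -> [set:: s] :+: [set:: take n s] = [set:: drop n s].
Proof.
move=> s_uniq; apply/setP => e; rewrite in_symdiff !inE.
rewrite -{1}(cat_take_drop n s) mem_cat.
have := s_uniq; rewrite -{1}(cat_take_drop n s) cat_uniq => /and3P[_ /hasPn disj _].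
have := disj e; case: (e \in drop n s) => [/(_ isT)/negbTE-> //|_].
by case: (e \in take n s).
Qed.

Lemma preceding_flip s e : uniq s -> e \in s ->
  preceding s e :+: [set e] = [set:: take (index e s).+1 s].
Proof.
move=> s_uniq es; apply/setP => f; rewrite in_symdiff !inE.
rewrite (take_nth e) ?index_mem // nth_index // mem_rcons in_cons.
have [->|_] := eqVneq f e; last by rewrite addbF.
by rewrite addbT /= in_take_leq ?ltnn // index_size.
Qed.

Lemma telescope_flips (V : zmodType) (g : {set {set T}} -> V) A s : uniq s ->
  g A - g (A :+: [set:: s]) =
  \sum_(e in [set:: s]) (g (A :+: preceding s e) - g (A :+: preceding s e :+: [set e])).
Proof.
move=> s_uniq; pose gtake i := g (A :+: [set:: take i s]).
under eq_bigl do rewrite inE; rewrite -big_uniq // (big_nth set0).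
transitivity (\sum_(0 <= i < size s) (gtake i - gtake i.+1)); last first.
  apply: eq_big_nat => i /andP[_ i_lt].
  by rewrite -symdiffA preceding_flip ?mem_nth // /preceding index_uniq.
under eq_bigr do rewrite -opprB; rewrite sumrN telescope_sumr // opprB.
by rewrite /gtake take0 take_size set_nil symdiff0.
Qed.

Lemma unwinding_oddv_le2 D s e : unwinding D s -> e \in D ->
  (#|oddv (D :+: preceding s e)| <= 2)%N /\
  (#|oddv (D :+: preceding s e :+: [set e])| <= 2)%N.
Proof.
move=> [s_uniq <- s_le2]; rewrite inE => es.
by rewrite -symdiffA preceding_flip // !set_take_drop.
Qed.

End Parity.

(** * Rates of the worm process *)

Section WormGraph.
Variables (T : finType) (adj : rel T).
Hypotheses (adj_sym : symmetric adj) (adj_irr : irreflexive adj).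
Implicit Types (A B D X : {set {set T}}) (e : {set T}) (u v : T).

Local Notation "A :+: B" := (symdiff A B) (at level 50, left associativity).
Local Notation flip A u v := (A :+: [set [set u; v]]).
Local Notation W := (Wset adj).

Lemma edgesP e : reflect (exists u v, adj u v /\ e = [set u; v]) (e \in edges adj).
Proof.
rewrite inE; apply: (iffP existsP) => [[u /existsP[v /andP[uv /eqP ->]]]|].
  by exists u, v.
by move=> [u [v [uv ->]]]; exists u; apply/existsP; exists v; rewrite uv eqxx.
Qed.

Lemma mem_edges u v : adj u v -> [set u; v] \in edges adj.
Proof. by move=> uv; apply/edgesP; exists u, v. Qed.

Lemma adj_neq u v : adj u v -> u != v.
Proof. by move=> uv; apply: contraTneq uv => ->; rewrite adj_irr. Qed.

Lemma card_edge e : e \in edges adj -> #|e| = 2%N.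
Proof. by case/edgesP => u [v [uv ->]]; rewrite cards2 adj_neq. Qed.

Lemma card_oddv_even A : A \subset edges adj -> ~~ odd #|oddv A|.
Proof. by move=> /subsetP AE; rewrite odd_card_oddv big1 // => e /AE /card_edge ->. Qed.

Lemma mem_Ck k A : (A \in Ck adj k) = (A \subset edges adj) && (#|oddv A| == k).
Proof. by rewrite inE. Qed.

Lemma mem_Wset A : (A \in W) = (A \subset edges adj) && (#|oddv A| <= 2)%N.
Proof.
rewrite inE !mem_Ck; case: (boolP (A \subset _)) => //= /card_oddv_even.
by case: #|_| => [|[|[|]]].
Qed.

Lemma card_oddv_Wset A : A \in W -> #|oddv A| != 0%N -> #|oddv A| = 2%N.
Proof. by rewrite mem_Wset => /andP[/card_oddv_even]; case: #|_| => [|[|[|]]]. Qed.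

Lemma flip_even_oddv A u v : #|oddv (flip A u v)| = 0%N -> oddv A = [set u; v].
Proof.
move/eqP; rewrite cards_eq0 => /eqP B0; apply/setP => x.
have := mem_oddv_flip A [set u; v] x; rewrite B0 in_set0.
by case: (x \in oddv A); case: (x \in _).
Qed.

Lemma flip_oddv_not_both A u v : adj u v -> A \in W ->
  #|oddv A| != 0%N -> #|oddv (flip A u v)| != 0%N ->
  ~~ ((u \in oddv A) && (v \in oddv A)).
Proof.
move=> uv AW A_odd; apply: contra => /andP[uA vA].
have E : oddv A = [set u; v].
  apply/esym/eqP; rewrite eqEcard (card_oddv_Wset AW A_odd) cards2 adj_neq //= andbT.
  by rewrite subUset !sub1set uA.
by rewrite cards_eq0; apply/eqP/setP => x; rewrite mem_oddv_flip E addbb in_set0.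
Qed.

Lemma flip_oddv_exactly_one A u v : adj u v -> A \in W -> flip A u v \in W ->
  #|oddv A| != 0%N -> #|oddv (flip A u v)| != 0%N -> (v \in oddv A) = (u \notin oddv A).
Proof.
move=> uv AW BW A_odd B_odd; have := flip_oddv_not_both uv AW A_odd B_odd.
have := flip_oddv_not_both uv BW B_odd; rewrite symdiffK => /(_ A_odd).
rewrite !mem_oddv_flip !in_set2 !eqxx orbT !addbT.
by case: (u \in _); case: (v \in _).
Qed.

(* The vertices at which the head of the worm may sit when the state is [A]. *)
Definition heads A : {set T} := if #|oddv A| == 0%N then setT else oddv A.

Lemma card_heads A : A \in W -> #|heads A| = if #|oddv A| == 0%N then #|T| else 2.
Proof.
rewrite /heads => AW; case: ifPn => [_|/(card_oddv_Wset AW)//]; exact: cardsT.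
Qed.

Variables (R : realType) (w : R) (M : {set {set T}}).

Local Notation lam := (lam w M).
Local Notation rate := (rate adj w M).
Local Notation Poff := (Poff adj w M).
Local Notation dg u := ((deg adj u)%:R : R).
Local Notation Delta := ((maxdeg adj)%:R : R).

Lemma lam_prod A : lam A = \prod_e (if e \in A :+: M then w else 1).
Proof. by rewrite /Defs.lam -prodr_const big_mkcond. Qed.

Lemma lam_exchange A D B : B \subset D ->
  lam A * lam (A :+: D) = lam (A :+: B) * lam (A :+: B :+: D).
Proof.
move=> /subsetP BD; rewrite !lam_prod -!big_split /=; apply: eq_bigr => e _.
rewrite !in_symdiff; have := BD e.
case: (e \in B); case: (e \in D) => // eD; rewrite ?addbF //; last by have := eD isT.
by case: (e \in A); case: (e \in M) => /=; rewrite mulrC.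
Qed.

Hypotheses (w_gt0 : 0 < w) (w_lt1 : w < 1).

Lemma lam_gt0 A : 0 < lam A.
Proof. exact: exprn_gt0. Qed.

Lemma lam_ge0 A : 0 <= lam A.
Proof. exact/ltW/lam_gt0. Qed.

Lemma lam_flip A e :
  lam (A :+: [set e]) = lam A * (if e \in A :+: M then w^-1 else w).
Proof.
rewrite !lam_prod (bigD1 e) //= [in RHS](bigD1 e) //= mulrAC.
congr (_ * _); last first.
  by apply: eq_bigr => f /negbTE fe; rewrite !in_symdiff inE fe addbF.
rewrite !in_symdiff inE eqxx addbT; case: (e \in A); case: (e \in M) => /=;
  by rewrite ?mul1r // divff // gt_eqF.
Qed.

Lemma lam_flip_ge A e : w * lam A <= lam (A :+: [set e]).
Proof.
rewrite lam_flip mulrC ler_pM2l ?lam_gt0 //; case: ifP => // _.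
by rewrite (@le_trans _ _ 1) ?invf_ge1 // ltW.
Qed.

Lemma lam_min A e :
  lam A * (if e \in A :+: M then 1 else w) = Num.min (lam A) (lam (A :+: [set e])).
Proof.
rewrite lam_flip -{2}[lam A]mulr1 -minr_pMr ?lam_ge0 //; congr (_ * _).
case: ifP => _; last by rewrite min_r // ltW.
by rewrite min_l // invf_ge1 // ltW.
Qed.

Lemma deg_gt0 u v : adj u v -> 0 < dg u.
Proof. by move=> uv; rewrite ltr0n; apply/card_gt0P; exists v; rewrite inE. Qed.

Lemma deg_gt0r u v : adj u v -> 0 < dg v.
Proof. by rewrite adj_sym => /deg_gt0. Qed.

Lemma deg_le_maxdeg u : dg u <= Delta.
Proof. by rewrite ler_nat /maxdeg (bigD1 u) //= leq_maxl. Qed.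

Lemma invf_maxdeg_le u v : adj u v -> Delta^-1 <= (dg u)^-1.
Proof.
move=> /deg_gt0 du; rewrite lef_pV2 ?deg_le_maxdeg //.
exact: lt_le_trans du (deg_le_maxdeg u).
Qed.

(* The unnormalised Prokof'ev--Svistunov measure. *)
Definition ps_weight A : R := #|heads A|%:R * lam A.

Lemma ps_weight_ge0 A : 0 <= ps_weight A.
Proof. by rewrite mulr_ge0 ?lam_ge0. Qed.

Lemma ps_weight_rate_even A u v : adj u v -> A \in W ->
  (#|oddv A| == 0%N) || (#|oddv (flip A u v)| == 0%N) ->
  ps_weight A * rate A u v =
  2^-1 * Num.min (lam A) (lam (flip A u v)) * ((dg u)^-1 + (dg v)^-1).
Proof.
move=> uv AW; rewrite /ps_weight card_heads // /Defs.rate -lam_min.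
have cardT_gt0 : 0 < #|T|%:R :> R by rewrite ltr0n; apply/card_gt0P; exists u.
move: (lam A) (_ + _) (if _ then 1 else w) => a d s.
case: eqP => [_ _|_ /= ->]; last by field.
by field; rewrite gt_eqF.
Qed.

Lemma ps_weight_rate_odd A u v : adj u v -> A \in W ->
  #|oddv A| != 0%N -> #|oddv (flip A u v)| != 0%N ->
  ps_weight A * rate A u v = 2^-1 *
    (if u \in oddv A then Num.min (lam (flip A u v) / dg v) (lam A / dg u)
     else Num.min (lam (flip A u v) / dg u) (lam A / dg v)).
Proof.
move=> uv AW A_odd B_odd; rewrite /ps_weight card_heads // /Defs.rate lam_flip.
rewrite (negbTE A_odd) (negbTE B_odd).
have du := deg_gt0 uv; have dv := deg_gt0r uv.
have metropolis (x y t : R) : 0 < x -> 0 < y ->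
    2 * lam A * (Num.min (x / y * t) 1 * (4 * x)^-1) =
    2^-1 * Num.min (lam A * t / y) (lam A / x).
  move=> x0 y0; have -> : lam A * t / y = lam A / x * (x / y * t).
    by field; rewrite !gt_eqF.
  rewrite -{2}[lam A / x]mulr1 -minr_pMr ?divr_ge0 ?lam_ge0 ?ltW //.
  by field; rewrite gt_eqF.
by case: ifP => _; rewrite metropolis.
Qed.

Lemma ps_weight_rateC A u v : adj u v -> A \in W -> flip A u v \in W ->
  ps_weight A * rate A u v = ps_weight (flip A u v) * rate (flip A u v) u v.
Proof.
move=> uv AW BW.
have [AB_even|] := boolP ((#|oddv A| == 0%N) || (#|oddv (flip A u v)| == 0%N)).
  rewrite (ps_weight_rate_even uv AW AB_even) (ps_weight_rate_even uv BW) symdiffK.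
    by rewrite minC.
  by rewrite orbC.
rewrite negb_or => /andP[A_odd B_odd].
rewrite (ps_weight_rate_odd uv AW) // (ps_weight_rate_odd uv BW) ?symdiffK //.
by rewrite mem_oddv_flip in_set2 eqxx addbT; case: (u \in oddv A) => /=; rewrite minC.
Qed.

Lemma ps_weight_rate_ge A u v : adj u v -> A \in W ->
  w / (2 * Delta) * lam A <= ps_weight A * rate A u v.
Proof.
move=> uv AW; have vu : adj v u by rewrite adj_sym.
have inv_u := invf_maxdeg_le uv; have inv_v := invf_maxdeg_le vu.
have lamA : w * lam A <= lam A by rewrite ger_pMl ?lam_gt0 // ltW.
have lamB := lam_flip_ge A [set u; v].
have wlam_ge0 : 0 <= w * lam A by rewrite mulr_ge0 ?lam_ge0 // ltW.
have -> : w / (2 * Delta) * lam A = 2^-1 * (w * lam A / Delta) by rewrite invfM; ring.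
have [AB_even|] := boolP ((#|oddv A| == 0%N) || (#|oddv (flip A u v)| == 0%N)).
  rewrite ps_weight_rate_even // -[leRHS]mulrA ler_pM2l ?invr_gt0 //.
  apply: ler_pM; rewrite ?invr_ge0 // ?le_min ?lamA //.
  by rewrite ler_wpDr ?invr_ge0.
rewrite negb_or => /andP[A_odd B_odd].
rewrite ps_weight_rate_odd // ler_pM2l ?invr_gt0 //.
by case: ifP => _; rewrite le_min !ler_pM ?invr_ge0.
Qed.

Lemma rate_ge0 A u v : 0 <= rate A u v.
Proof.
have w_ge0 := ltW w_gt0.
have metropolis_ge0 (x y t : R) : 0 <= x -> 0 <= y -> 0 <= t ->
    0 <= Num.min (x / y * t) 1 * (4 * x)^-1.
  move=> x0 y0 t0; rewrite mulr_ge0 ?invr_ge0 ?mulr_ge0 // le_min ler01 andbT.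
  by rewrite !mulr_ge0 ?invr_ge0.
by rewrite /Defs.rate; do 3?case: ifP => _;
  rewrite ?metropolis_ge0 // ?mulr_ge0 ?addr_ge0 ?invr_ge0 ?mulr_ge0 //; case: ifP;
  rewrite ?invr_ge0.
Qed.

Lemma Poff_ge0 A B : 0 <= Poff A B.
Proof.
rewrite mulr_ge0 ?invr_ge0 // sumr_ge0 // => u _; rewrite sumr_ge0 // => v _.
exact: rate_ge0.
Qed.

Lemma ps_weight_PoffC A B : A \in W -> B \in W ->
  ps_weight A * Poff A B = ps_weight B * Poff B A.
Proof.
move=> AW BW; rewrite /Defs.Poff mulrCA [RHS]mulrCA; congr (_ * _).
rewrite !mulr_sumr; apply: eq_bigr => u _; rewrite !mulr_sumr.
apply: eq_big => [v|v /andP[uv /eqP BE]].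
  by congr (_ && _); apply/eqP/eqP => ->; rewrite symdiffK.
by rewrite BE ps_weight_rateC // -BE.
Qed.

Lemma sum_Poff A (F : {set {set T}} -> R) :
  \sum_(B in W) Poff A B * F B =
  2^-1 * \sum_u \sum_(v | adj u v && (flip A u v \in W)) rate A u v * F (flip A u v).
Proof.
rewrite mulr_sumr; under eq_bigr => B _.
  rewrite /Defs.Poff -mulrA mulr_suml mulr_sumr; over.
rewrite exchange_big /=; apply: eq_bigr => u _.
under eq_bigr => B _.
  rewrite mulr_suml mulr_sumr big_mkcondr /=; over.
rewrite exchange_big /= mulr_sumr [in RHS]big_mkcondr /=; apply: eq_bigr => v _.
by rewrite -big_mkcondr big_andbC big_mkcondr /= big_pred1_eq.
Qed.

Lemma sum_adj_deg (S : {set T}) :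
  \sum_u \sum_(v | adj u v) (u \in S)%:R / dg u <= #|S|%:R.
Proof.
rewrite -sum1_card natr_sum big_mkcond /= [leRHS]big_mkcond; apply: ler_sum => u _.
rewrite sumr_const; case: (u \in S); last by rewrite mul0r mul0rn.
rewrite -[leLHS]mulr_natr /= mul1r.
have -> : #|[pred v | adj u v]| = deg adj u by apply: eq_card => v; rewrite !inE.
have [->|deg_neq0] := eqVneq (dg u) 0; first by rewrite mulr0 ler01.
by rewrite mulVf.
Qed.

Lemma sum_adj_degr (S : {set T}) :
  \sum_u \sum_(v | adj u v) (v \in S)%:R / dg v <= #|S|%:R.
Proof.
rewrite (exchange_big_dep xpredT) //=; apply: le_trans (sum_adj_deg S).
by apply: ler_sum => u _; under eq_bigl do rewrite adj_sym.
Qed.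

Lemma rate_le_heads A u v : A \in W -> adj u v -> flip A u v \in W ->
  rate A u v <=
  (2 * #|heads A|%:R)^-1 * ((u \in heads A)%:R / dg u + (v \in heads A)%:R / dg v).
Proof.
move=> AW uv BW; rewrite card_heads // /heads /Defs.rate.
have accept_le1 : (if [set u; v] \in A :+: M then 1 else w) <= 1.
  by case: ifP => // _; exact: ltW.
have inv4 : (4^-1 : R) = (2 * 2)^-1 by rewrite -natrM.
have [A_even|A_odd] := boolP (#|oddv A| == 0%N).
  rewrite !in_setT !mul1r; apply: ler_piMl => //.
  by rewrite mulr_ge0 ?invr_ge0 ?mulr_ge0 // addr_ge0 ?invr_ge0.
have [B_even|B_odd] := boolP (#|oddv (flip A u v)| == 0%N).
  rewrite (flip_even_oddv (eqP B_even)) !in_set2 !eqxx orbT !mul1r -inv4.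
  by apply: ler_piMl => //; rewrite mulr_ge0 ?invr_ge0 // addr_ge0 ?invr_ge0.
rewrite (flip_oddv_exactly_one uv AW BW A_odd B_odd).
have metropolis_le (x t : R) : 0 <= x -> Num.min t 1 * (4 * x)^-1 <= (2 * 2)^-1 * x^-1.
  move=> x0; rewrite invfM -inv4; apply: ler_piMl; last by rewrite ge_min lexx orbT.
  by rewrite mulr_ge0 ?invr_ge0.
by case: (u \in oddv A) => /=; rewrite mul0r mul1r ?addr0 ?add0r metropolis_le.
Qed.

Lemma sum_Poff_le_half A : A \in W -> \sum_(B in W) Poff A B <= 2^-1.
Proof.
move=> AW; under eq_bigr do rewrite -[Poff A _]mulr1.
rewrite (sum_Poff A (fun=> 1)) -[leRHS]mulr1 ler_pM2l ?invr_gt0 //.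
have rates_le : \sum_u \sum_(v | adj u v && (flip A u v \in W)) rate A u v * 1 <=
    (2 * #|heads A|%:R)^-1 *
      (\sum_u \sum_(v | adj u v) (u \in heads A)%:R / dg u +
       \sum_u \sum_(v | adj u v) (v \in heads A)%:R / dg v).
  rewrite -big_split mulr_sumr; apply: ler_sum => u _ /=.
  rewrite -big_split mulr_sumr big_mkcondr /=; apply: ler_sum => v uv.
  case: ifP => BW; first by rewrite mulr1; exact: rate_le_heads.
  by rewrite mulr_ge0 ?invr_ge0 ?addr_ge0 ?mulr_ge0 ?invr_ge0.
apply: le_trans rates_le _.
have [->|heads_neq0] := eqVneq (#|heads A|%:R : R) 0.
  by rewrite mulr0 invr0 mul0r.
have heads_gt0 : 0 < 2 * #|heads A|%:R :> R by rewrite mulr_gt0 // lt_def heads_neq0 /=.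
rewrite ler_pdivrMl // mulr1 mulr2n mulrDl mul1r.
by rewrite lerD ?sum_adj_deg ?sum_adj_degr.
Qed.

(** * Canonical paths *)

Lemma sum_edges_le (P : pred {set T}) (h : {set T} -> R) : (forall e, 0 <= h e) ->
  \sum_(e in edges adj | P e) h e <=
  \sum_u \sum_(v | adj u v && P [set u; v]) h [set u; v].
Proof.
move=> h_ge0; rewrite pair_big_dep /=.
rewrite (partition_big (fun uv : T * T => [set uv.1; uv.2])
          (fun e => (e \in edges adj) && P e)) /=; last first.
  by move=> [u v] /= /andP[uv ->]; rewrite mem_edges.
apply: ler_sum => e /andP[/edgesP[u [v [uv ->]]] Pe].
rewrite (bigD1 (u, v)) /=; last by rewrite uv Pe eqxx.
by rewrite ler_wpDr // sumr_ge0.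
Qed.

Definition energy (g : {set {set T}} -> R) : R :=
  2^-1 * \sum_(X in W) \sum_(Y in W) ps_weight X * Poff X Y * (g X - g Y) ^+ 2.

Lemma energy_ge0 g : 0 <= energy g.
Proof.
rewrite mulr_ge0 ?invr_ge0 // sumr_ge0 // => X _; rewrite sumr_ge0 // => Y _.
by rewrite mulr_ge0 ?sqr_ge0 // mulr_ge0 ?ps_weight_ge0 ?Poff_ge0.
Qed.

Lemma sum_flips_le_energy g :
  \sum_(X in W) \sum_(e in edges adj | X :+: [set e] \in W)
    lam X * (g X - g (X :+: [set e])) ^+ 2 <= 8 * Delta / w * energy g.
Proof.
have -> : 8 * Delta / w * energy g = 4 * Delta / w *
    \sum_(X in W) \sum_(Y in W) ps_weight X * Poff X Y * (g X - g Y) ^+ 2.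
  by rewrite /energy; field; rewrite gt_eqF.
rewrite mulr_sumr; apply: ler_sum => X XW; apply: le_trans (sum_edges_le _ _) _.
  by move=> e; rewrite mulr_ge0 ?sqr_ge0 ?lam_ge0.
under [X in _ <= _ * X]eq_bigr do rewrite -mulrA.
rewrite -mulr_sumr (sum_Poff X (fun Y => (g X - g Y) ^+ 2)) !mulr_sumr.
apply: ler_sum => u _; rewrite !mulr_sumr; apply: ler_sum => v /andP[uv _].
have Delta_gt0 : 0 < Delta := lt_le_trans (deg_gt0 uv) (deg_le_maxdeg u).
have flow_ge := ps_weight_rate_ge uv XW.
have := sqr_ge0 (g X - g (flip X u v)).
move: (rate X u v) flow_ge (_ ^+ 2) => q flow_ge d d_ge0.
have -> : 4 * Delta / w * (ps_weight X * (2^-1 * (q * d))) =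
    2 * Delta / w * (ps_weight X * q) * d by field; rewrite gt_eqF.
apply: ler_wpM2r => //; rewrite -ler_pdivrMl ?divr_gt0 ?mulr_gt0 //.
by rewrite invf_div.
Qed.

Section CanonicalPaths.
Variable order : {set {set T}} -> seq {set T}.
Hypothesis orderP : forall D, D \subset edges adj -> (#|oddv D| <= 2)%N ->
  unwinding D (order D).

Local Notation pre D e := (preceding (order D) e).

(* The path from [A] to the even subgraph [A :+: D] flips the edges of [D] one by one in
   the order [order D]; it flips [e] at [X] exactly when [A = X :+: pre D e]. *)
Definition routed X D e : bool :=
  [&& e \in D, X :+: pre D e \in W & X :+: pre D e :+: D \in Ck adj 0].

Lemma even_target A D : A \in W -> A :+: D \in Ck adj 0 ->
  [/\ D \subset edges adj, (#|oddv D| <= 2)%N & oddv D = oddv A].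
Proof.
rewrite mem_Wset mem_Ck cards_eq0 => /andP[AE A_le2] /andP[BE /eqP B_even].
have DA : oddv D = oddv A by rewrite -(oddv_symdiff_even A B_even) symdiffC symKdiff.
by rewrite DA -(symKdiff A D) symdiff_sub.
Qed.

Lemma routed_flip X D e : routed X D e ->
  [/\ X \in W, e \in edges adj, X :+: [set e] \in W & pre D e \subset D].
Proof.
case/and3P => eD AW BC; have [DE D_le2 _] := even_target AW BC.
have D_order := orderP DE D_le2; have [X_le2 Xe_le2] := unwinding_oddv_le2 D_order eD.
have preD : pre D e \subset D.
  by have := preceding_sub (order D) e; case: D_order => _ -> _.
move: BC; rewrite mem_Ck cards_eq0 => /andP[BE /eqP B_even].
have X_eq : X = (X :+: pre D e :+: D) :+: (D :+: pre D e).
  by rewrite (symdiffC D) -(symdiffA (X :+: _)) (symdiffC (pre D e)) symKdiff symdiffK.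
have eE := subsetP DE e eD.
have XE : X \subset edges adj.
  by rewrite X_eq symdiff_sub // symdiff_sub // (subset_trans preD).
split=> //; rewrite mem_Wset ?XE ?symdiff_sub ?sub1set //= X_eq.
  by rewrite oddv_symdiff_even.
by rewrite -symdiffA oddv_symdiff_even.
Qed.

Lemma routed_encoding X D e : routed X D e ->
  X :+: D \in (if #|oddv (X :+: pre D e)| == 0%N then W else W :|: Ck adj 4).
Proof.
move=> rX; have [XW _ _ _] := routed_flip rX; case/and3P: rX => eD AW BC.
have [DE D_le2 DA] := even_target AW BC; move: XW; rewrite mem_Wset => /andP[XE X_le2].
have XDE : X :+: D \subset edges adj by rewrite symdiff_sub.
case: ifP => [|_].
  rewrite cards_eq0 -DA => /eqP D_even.
  by rewrite mem_Wset XDE symdiffC oddv_symdiff_even.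
rewrite in_setU mem_Wset mem_Ck XDE /=.
have := card_oddv_symdiff X D; have := card_oddv_even XDE; lia.
Qed.

Definition load : R :=
  #|T|%:R * (\sum_(A in W) lam A) + 2 * (\sum_(A in W :|: Ck adj 4) lam A).

Lemma load_ge0 : 0 <= load.
Proof. by rewrite addr_ge0 // mulr_ge0 // sumr_ge0 // => A _; exact: lam_ge0. Qed.

(* [D] is recovered from the encoding [X :+: D], so each subgraph is counted once. *)
Lemma congestion_le X e :
  \sum_(D | routed X D e) #|heads (X :+: pre D e)|%:R * lam (X :+: D) <= load.
Proof.
rewrite (reindex_inj (@symdiff_inj _ X)) /load !mulr_sumr.
rewrite big_mkcond [X in _ <= X + _]big_mkcond [X in _ <= _ + X]big_mkcond -big_split.
apply: ler_sum => eta _ /=; set D := eta :+: X.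
have -> : X :+: D = eta by rewrite symdiffC symdiffK.
case: ifP => [rX|_]; last first.
  by rewrite addr_ge0 //; case: ifP => // _; rewrite mulr_ge0 ?lam_ge0.
have := routed_encoding rX; have /and3P[_ AW _] := rX.
rewrite card_heads // /D (symdiffC X) symdiffK; case: ifP => _ ->.
  by rewrite lerDl; case: ifP => // _; rewrite mulr_ge0 ?lam_ge0.
by rewrite lerDr; case: ifP => // _; rewrite mulr_ge0 ?lam_ge0.
Qed.

Variable g : {set {set T}} -> R.
Local Notation sqr_grad X e := ((g X - g (X :+: [set e])) ^+ 2).

Lemma sqr_dist_le_path A D : A \in W -> A :+: D \in Ck adj 0 ->
  (g A - g (A :+: D)) ^+ 2 <=
  #|edges adj|%:R * \sum_(e in D) sqr_grad (A :+: pre D e) e.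
Proof.
move=> AW BC; have [DE D_le2 _] := even_target AW BC.
have [s_uniq sE _] := orderP DE D_le2.
have -> : g A - g (A :+: D) =
    \sum_(e in D) (g (A :+: pre D e) - g (A :+: pre D e :+: [set e])).
  by have := telescope_flips g A s_uniq; rewrite sE.
apply: le_trans (sqr_sum_le _ _) _; apply: ler_wpM2r.
  by apply: sumr_ge0 => e _; exact: sqr_ge0.
by rewrite ler_nat subset_leq_card.
Qed.

Lemma sum_paths_by_flip :
  \sum_(A in W) \sum_(D | A :+: D \in Ck adj 0) \sum_(e in D)
    ps_weight A * lam (A :+: D) * sqr_grad (A :+: pre D e) e =
  \sum_X \sum_e lam X * sqr_grad X e *
    \sum_(D | routed X D e) #|heads (X :+: pre D e)|%:R * lam (X :+: D).
Proof.
transitivity (\sum_(D : {set {set T}}) \sum_(e : {set T})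
    \sum_(A | [&& e \in D, A \in W & A :+: D \in Ck adj 0])
    ps_weight A * lam (A :+: D) * sqr_grad (A :+: pre D e) e).
  rewrite (exchange_big_dep xpredT) //=; apply: eq_bigr => D _.
  rewrite exchange_big big_mkcond; apply: eq_bigr => e _ /=.
  by case: (e \in D) => //; rewrite big_pred0.
rewrite exchange_big [RHS]exchange_big /=; apply: eq_bigr => e _.
under [RHS]eq_bigr do rewrite mulr_sumr.
rewrite [RHS](exchange_big_dep xpredT) //=; apply: eq_bigr => D _.
rewrite (reindex_inj (@symdiff_inj _ (pre D e))); apply: eq_bigr => X rX.
have [_ _ _ preD] := routed_flip rX.
by rewrite /ps_weight -(mulrA _ (lam _) (lam _)) (lam_exchange _ preD) symdiffK; ring.
Qed.

Lemma sum_paths_le_energy :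
  \sum_(A in W) \sum_(D | A :+: D \in Ck adj 0) \sum_(e in D)
    ps_weight A * lam (A :+: D) * sqr_grad (A :+: pre D e) e <=
  load * (8 * Delta / w * energy g).
Proof.
apply: le_trans (ler_wpM2l load_ge0 (sum_flips_le_energy g)).
rewrite sum_paths_by_flip mulr_sumr [leRHS]big_mkcond; apply: ler_sum => X _.
have unrouted e : ~~ [&& X \in W, e \in edges adj & X :+: [set e] \in W] ->
    \sum_(D | routed X D e) #|heads (X :+: pre D e)|%:R * lam (X :+: D) = 0.
  move=> no_flip; apply: big_pred0 => D; apply: contraNF no_flip.
  by case/routed_flip => -> -> ->.
case: ifP => XW; last by rewrite big1 // => e _; rewrite unrouted ?XW // mulr0.
rewrite mulr_sumr [leRHS]big_mkcond; apply: ler_sum => e _.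
case: ifP => eW; last by rewrite unrouted ?XW ?eW // mulr0.
rewrite [leRHS]mulrC; apply: ler_wpM2l; last exact: congestion_le.
by rewrite mulr_ge0 ?sqr_ge0 ?lam_ge0.
Qed.

Lemma canonical_paths : \sum_(A in W) ps_weight A * g A = 0 ->
  lamS w M (Ck adj 0) * \sum_(A in W) ps_weight A * g A ^+ 2 <=
  #|edges adj|%:R * (load * (8 * Delta / w * energy g)).
Proof.
move=> mean0.
apply: le_trans (second_moment_le (mem (Ck adj 0)) ps_weight_ge0 lam_ge0 mean0) _.
apply: le_trans (ler_wpM2l (ler0n _ _) sum_paths_le_energy); rewrite mulr_sumr.
apply: ler_sum => A AW; rewrite (reindex_inj (@symdiff_inj _ A)) mulr_sumr.
under eq_bigl do rewrite symdiffC; apply: ler_sum => D BC.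
rewrite (symdiffC D A) -mulr_sumr [leRHS]mulrCA.
by apply: ler_wpM2l (sqr_dist_le_path AW BC); rewrite mulr_ge0 ?ps_weight_ge0 ?lam_ge0.
Qed.

End CanonicalPaths.

Local Notation lamC k := (lamS w M (Ck adj k)).

Lemma lamS_Ck0_gt0 : 0 < lamC 0.
Proof.
rewrite /lamS (bigD1 set0) /=; last by rewrite mem_Ck sub0set oddv0 cards0.
by rewrite ltr_wpDr ?lam_gt0 // sumr_ge0 // => A _; exact: lam_ge0.
Qed.

Lemma sum_lam_Wset : \sum_(A in W) lam A = lamC 0 + lamC 2.
Proof.
rewrite /Wset /lamS -bigU //=; first by apply: eq_bigl => A; rewrite inE.
by apply/pred0P => A /=; rewrite !mem_Ck; case: eqP => [->|]; rewrite ?andbF.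
Qed.

Lemma sum_lam_Wset_Ck4 : \sum_(A in W :|: Ck adj 4) lam A = lamC 0 + lamC 2 + lamC 4.
Proof.
rewrite -sum_lam_Wset /lamS -bigU //=; first by apply: eq_bigl => A; rewrite inE.
apply/pred0P => A /=; rewrite mem_Wset mem_Ck.
by case: (#|oddv A| =P 4%N) => [->|]; rewrite ?andbF.
Qed.

Lemma load_le (chi2 chi4 : R) : lamC 2 / lamC 0 <= chi2 -> lamC 4 / lamC 0 <= chi4 ->
  load <= lamC 0 * ((1 + chi2) * (2 + #|T|%:R) + 2 * chi4).
Proof.
rewrite /load sum_lam_Wset sum_lam_Wset_Ck4 !ler_pdivrMr ?lamS_Ck0_gt0 //.
have := ler0n R #|T|; move: (lamC 0) (lamC 2) (lamC 4) (#|T|%:R : R).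
by move=> l0 l2 l4 n n_ge0 l2_le l4_le; nra.
Qed.

Lemma worm_poincare (chi2 chi4 : R) (g : {set {set T}} -> R) :
  lamC 2 / lamC 0 <= chi2 -> lamC 4 / lamC 0 <= chi4 ->
  \sum_(A in W) ps_weight A * g A = 0 ->
  \sum_(A in W) ps_weight A * g A ^+ 2 <=
  8 * Delta * w^-1 * #|edges adj|%:R *
    ((1 + chi2) * (2 + #|T|%:R) + 2 * chi4) * energy g.
Proof.
move=> chi2P chi4P mean0; have lamC0_gt0 := lamS_Ck0_gt0.
have [order orderP] := exists_unwinding_order T.
have {}orderP D : D \subset edges adj -> (#|oddv D| <= 2)%N -> unwinding D (order D).
  by move=> /subsetP DE; apply: orderP => e /DE /card_edge.
rewrite -(ler_pM2l lamC0_gt0); apply: le_trans (canonical_paths orderP mean0) _.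
have := load_le chi2P chi4P; set K := (1 + chi2) * _ + _ => load_leK.
have -> : lamC 0 * (8 * Delta * w^-1 * #|edges adj|%:R * K * energy g) =
    #|edges adj|%:R * (lamC 0 * K * (8 * Delta / w * energy g)) by ring.
apply: ler_wpM2l => //; apply: ler_wpM2r => //.
by rewrite mulr_ge0 ?energy_ge0 // divr_ge0 ?mulr_ge0 // ltW.
Qed.

End WormGraph.

Section WormChain.
Variables (T : finType) (adj : rel T) (R : realType) (w : R) (M : {set {set T}}).
Hypotheses (adj_sym : symmetric adj) (adj_irr : irreflexive adj).
Hypotheses (w_gt0 : 0 < w) (w_lt1 : w < 1).

Local Notation P := (@Pw T adj R w M).
Local Notation ps x := (ps_weight w M (val x)).

Lemma Pw_neq (x y : Wty adj) : x != y -> P x y = Poff adj w M (val x) (val y).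
Proof. by rewrite /Pw => /negbTE ->. Qed.

Lemma Pw_lazy : lazy P.
Proof.
move=> x; rewrite /Pw eqxx.
have : \sum_(y : Wty adj | y != x) Poff adj w M (val x) (val y) <= 2^-1.
  apply: le_trans (sum_Poff_le_half adj_sym adj_irr M w_lt1 (valP x)).
  by rewrite [leRHS]big_sub [leRHS](bigD1 x) //= lerDr Poff_ge0.
by move: (\sum_(_ | _) _) => S; lra.
Qed.

Lemma Pw_stochastic : stochastic P.
Proof.
split=> [x y|x].
  have [->|xy] := eqVneq x y; last by rewrite Pw_neq // Poff_ge0.
  by apply: le_trans (Pw_lazy y); rewrite invr_ge0.
rewrite (bigD1 x) //= {1}/Pw eqxx.
rewrite [X in _ + X](eq_bigr (fun y => Poff adj w M (val x) (val y))).
  by rewrite subrK.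
by move=> y yx; rewrite Pw_neq // eq_sym.
Qed.

Lemma Pw_reversible : reversible (fun x => ps x) P.
Proof.
move=> x y; have [-> //|xy] := eqVneq x y.
by rewrite !Pw_neq // 1?eq_sym // ps_weight_PoffC ?(valP x) ?(valP y).
Qed.

Lemma dirichlet_Pw (g : {set {set T}} -> R) :
  dirichlet (fun x => ps x) P (fun x => g (val x)) = energy adj w M g.
Proof.
rewrite /dirichlet /energy; congr (_ * _); rewrite [RHS]big_sub; apply: eq_bigr => x _.
rewrite [RHS]big_sub; apply: eq_bigr => y _.
have [->|xy] := eqVneq x y; last by rewrite Pw_neq.
by rewrite subrr expr0n /= !mulr0.
Qed.

Lemma Pw_poincare (chi2 chi4 : R) :
  lamS w M (Ck adj 2) / lamS w M (Ck adj 0) <= chi2 ->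
  lamS w M (Ck adj 4) / lamS w M (Ck adj 0) <= chi4 ->
  poincare_inequality (fun x => ps x) P
    (8 * (maxdeg adj)%:R * w^-1 * #|edges adj|%:R *
     ((1 + chi2) * (2 + #|T|%:R) + 2 * chi4)).
Proof.
move=> chi2P chi4P h; pose g A := if insub A is Some x then h x else 0 : R.
have -> : h = fun x => g (val x) by apply: funext => x; rewrite /g valK.
rewrite dirichlet_Pw => mean0.
have := worm_poincare adj_sym adj_irr w_gt0 w_lt1 chi2P chi4P (g := g).
by rewrite !(big_sub (Wset adj)); apply.
Qed.

Lemma ps_weight_gt0 (x : Wty adj) : (0 < #|T|)%N -> 0 < ps x.
Proof.
move=> T_gt0; rewrite mulr_gt0 ?lam_gt0 // ltr0n (card_heads adj_irr (valP x)).
by case: ifP.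
Qed.

Lemma Wty_subsingleton : #|T| = 0%N -> forall x y : Wty adj, x = y.
Proof.
move=> T0 x y; apply: val_inj; apply/setP => e.
have no_edge (z : Wty adj) : e \notin val z.
  have := valP z; rewrite mem_Wset // => /andP[/subsetP zE _].
  by apply/negP => /zE /edgesP[u]; have := fintype0 u T0.
by rewrite !(negbTE (no_edge _)).
Qed.

End WormChain.

Theorem theorem1 (T : finType) (adj : rel T)
  (adj_sym : symmetric adj) (adj_irr : irreflexive adj)
  (R : realType) (w : R) (M : {set {set T}}) (chi2 chi4 : R) :
  0 < w -> w < 1 -> M \subset edges adj ->
  lamS w M (Ck adj 2) / lamS w M (Ck adj 0) <= chi2 ->
  lamS w M (Ck adj 4) / lamS w M (Ck adj 0) <= chi4 ->
  trel_le adj w M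
    (8 * (maxdeg adj)%:R * w^-1 * (#|edges adj|)%:R *
     ((1 + chi2) * (2 + (#|T|)%:R) + 2 * chi4)).
Proof.
move=> w_gt0 w_lt1 _ chi2P chi4P mu mu_eigen mu_neq1.
have P_stoch := Pw_stochastic M adj_sym adj_irr w_gt0 w_lt1.
have [T0|T_gt0] := posnP #|T|.
  (* Without vertices [ps_weight] vanishes, but there is a single state. *)
  have mu1 := eigenvalue_subsingleton (Wty_subsingleton adj_irr T0) P_stoch.2 mu_eigen.
  by rewrite mu1 eqxx in mu_neq1.
apply: (spectral_gap_poincare (r := fun x => ps_weight w M (val x)) _ _ P_stoch) => //.
- by move=> x; exact: ps_weight_gt0.
- exact: Pw_reversible.
- exact: Pw_lazy.
- exact: Pw_poincare.
Qed.
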